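(* Let $F:\mathbb{R}^d\to\mathbb{R}$ be $L$-smooth and bounded from below by $F^*\in\mathbb{R}$, and let $\nabla f(x,\xi)$ be a stochastic gradient oracle satisfying, for some $p\in(1,2]$ and $\sigma\in(0,\infty)$, $\mathbb{E}[\nabla f(x,\xi)]=\nabla F(x)$ and $\mathbb{E}[|\nabla f(x,\xi)|^p]\le\sigma^p$ for all $x\in\mathbb{R}^d$. Let $T,n\in\mathbb{N}_{\ge1}$, let $x_1\in\mathbb{R}^d$ and $\Delta_1:=F(x_1)-F^*$. Then for any step sizes $\eta_1,\dots,\eta_T$ with $0<\eta_t<1/L$, the iterates $x_1,\dots,x_T$ generated by PS-Clip-SGD with batch size $n$ and parameters $\alpha=\sigma$, $\beta=p$ satisfy $$\sum_{t=1}^T\frac{\eta_t\,\mathbb{E}\big(|\nabla F(x_t)|^2\big)}{\sum_{t=1}^T\eta_t}\le\frac{2\Delta_1}{\sum_{t=1}^T\eta_t}+8\sigma^2 n^{-\frac{2(p-1)}{p}}.$$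
   Context: $|\cdot|$ is the Euclidean norm on $\mathbb{R}^d$, $d\ge1$. $F$ is $L$-smooth ($L>0$) if it is differentiable and $|\nabla F(x)-\nabla F(y)|\le L|x-y|$ for all $x,y\in\mathbb{R}^d$. The stochastic gradient oracle is a (measurable) map $(x,\xi)\mapsto\nabla f(x,\xi)\in\mathbb{R}^d$, where $\xi$ is a random variable with distribution $\mathcal{D}$; expectations in the oracle assumptions are over $\xi\sim\mathcal{D}$. PS-Clip-SGD (per-sample clipped SGD) with parameters $\alpha,\beta>0$, batch size $n$ and deterministic step sizes $\eta_t>0$, started at a deterministic point $x_1$: at each iteration $t=1,\dots,T$ draw i.i.d. samples $\xi_t^{(1)},\dots,\xi_t^{(n)}\sim\mathcal{D}$, independent of the samples of all previous iterations (hence independent of $x_t$), and set $$G(x_t,\alpha,\beta)=\frac1n\sum_{k=1}^n\gamma_t^{(k)}\nabla f(x_t,\xi_t^{(k)}),\qquad \gamma_t^{(k)}=\min\Big\{1,\frac{\alpha k^{1/\beta}}{|\nabla f(x_t,\xi_t^{(k)})|}\Big\}$$ (with $\gamma_t^{(k)}=1$ if $\nabla f(x_t,\xi_t^{(k)})=0$), and $x_{t+1}=x_t-\eta_t G(x_t,\alpha,\beta)$. *)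

(* Defs.v *)
From mathcomp Require Import all_boot all_order all_algebra finmap.
From mathcomp Require Import all_classical all_reals all_analysis.
Import Order.TTheory GRing.Theory Num.Theory.
Import numFieldNormedType.Exports.

Set Implicit Arguments.
Unset Strict Implicit.
Unset Printing Implicit Defensive.

Local Open Scope classical_set_scope.
Local Open Scope ring_scope.

(* The library norm `|v| on 'rV[R]_d is the sup norm. *)
Definition enorm (R : realType) (d : nat) (v : 'rV[R]_d) : R :=
  Num.sqrt (\sum_(i < d) v 0 i ^+ 2).

Definition grad (R : realType) (d : nat) (F : 'rV[R]_d -> R) (x : 'rV[R]_d) :
  'rV[R]_d := \row_(i < d) 'D_(delta_mx 0 i) F x.

Definition L_smooth (R : realType) (d : nat) (L : R) (F : 'rV[R]_d -> R) :=
  (forall x, differentiable F x) /\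
  (forall x y, enorm (grad F x - grad F y) <= L * enorm (x - y)).

(* R^d with its Borel sigma-algebra. *)
Notation borelRd R d := (g_sigma_algebraType (@open 'rV[R]_d)).

Section oracle.
Context (R : realType) (d : nat) (dX : measure_display)
  (Xi : measurableType dX) (D : probability Xi R).

Definition measurable_oracle (g : 'rV[R]_d -> Xi -> 'rV[R]_d) :=
  measurable_fun [set: borelRd R d * Xi]
    (fun u : borelRd R d * Xi => g u.1 u.2 : borelRd R d).

(* E[g x xi] = grad F x is an identity in R^d, stated coordinatewise. A finite
   value of the expectation forces each coordinate to be integrable. *)
Definition unbiased (F : 'rV[R]_d -> R) (g : 'rV[R]_d -> Xi -> 'rV[R]_d) :=
  forall (x : 'rV[R]_d) (i : 'I_d),
    ('E_D[fun z => (g x z 0 i)%R] = (grad F x 0 i)%R%:E)%E.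

Definition bounded_moment (p sigma : R) (g : 'rV[R]_d -> Xi -> 'rV[R]_d) :=
  forall x : 'rV[R]_d,
    ('E_D[fun z => (enorm (g x z) `^ p)%R] <= (sigma `^ p)%R%:E)%E.

End oracle.

Section sampling.
Context (R : realType) (dO : measure_display) (Omega : measurableType dO)
  (P : probability Omega R) (dX : measure_display) (Xi : measurableType dX).

Definition mutually_independent (I : choiceType) (K : set I)
    (X : I -> {mfun Omega >-> Xi}) :=
  forall (J : {fset I}) (A : I -> set Xi),
    [set` J] `<=` K -> (forall i, i \in J -> measurable (A i)) ->
    (P (\bigcap_(i in [set` J]) (X i @^-1` A i)) =
     \prod_(i <- J) P (X i @^-1` A i))%E.

(* xi t k is the k-th sample drawn at iteration t; only the indices
   1 <= t <= T and 1 <= k <= n matter. *)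
Definition iid_samples (D : probability Xi R) (T n : nat)
    (xi : nat -> nat -> {mfun Omega >-> Xi}) :=
  (forall t k : nat, (1 <= t <= T)%N -> (1 <= k <= n)%N ->
     forall A : set Xi, measurable A -> distribution P (xi t k) A = D A) /\
  mutually_independent
    [set tk : nat * nat | (1 <= tk.1 <= T)%N /\ (1 <= tk.2 <= n)%N]
    (fun tk => xi tk.1 tk.2).

End sampling.

Section ps_clip_sgd.
Context (R : realType) (d : nat).

Definition clip_factor (alpha beta : R) (k : nat) (v : 'rV[R]_d) : R :=
  if v == 0 then 1
  else Num.min 1 (alpha * k%:R `^ beta^-1 / enorm v).

Definition clipped_gradient (Xi : Type) (g : 'rV[R]_d -> Xi -> 'rV[R]_d)
    (alpha beta : R) (n : nat) (x : 'rV[R]_d) (z : nat -> Xi) : 'rV[R]_d :=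
  n%:R^-1 *: \sum_(1 <= k < n.+1)
    clip_factor alpha beta k (g x (z k)) *: g x (z k).

(* Iterations are numbered from 1, so x 0 is a junk value. *)
Definition ps_clip_sgd (Omega Xi : Type) (g : 'rV[R]_d -> Xi -> 'rV[R]_d)
    (alpha beta : R) (n T : nat) (eta : nat -> R)
    (xi : nat -> nat -> Omega -> Xi) (x1 : 'rV[R]_d)
    (x : nat -> Omega -> 'rV[R]_d) :=
  (forall w, x 1%N w = x1) /\
  (forall (t : nat) w, (1 <= t <= T)%N ->
     x t.+1 w = x t w -
       eta t *: clipped_gradient g alpha beta n (x t w) (fun k => xi t k w)).

End ps_clip_sgd.

(* Main.v *)
(** Write [z] for the gradient error of a step.  Smoothness and [eta < 1/L] give
    [F (x_(t+1)) <= F x_t + eta/2 (|z|^2 - |grad F x_t|^2)], so after telescoping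
    it suffices to bound [E |z|^2].  With thresholds [sigma k^(1/p)], the [k]-th
    clipped sample has bias at most [sigma k^(1/p - 1)] and second central moment
    at most [sigma^2 k^(2/p - 1)] plus the squared bias.  The deviations of two
    distinct samples of a batch are independent given [x_t], so that
    [n^2 E |z|^2 <= (sum of the biases)^2 + sum of the variances], which is at
    most [(2 sigma n^(1/p))^2 + sigma^2 n^(2/p)]: this proves the bound with [5]
    in place of [8].  Clipping keeps every iterate in a deterministic ball, hence
    all the random variables involved are bounded. *)
From HB Require Import structures.
Require Import Defs.
From mathcomp Require Import all_boot all_order all_algebra finmap.
From mathcomp Require Import all_classical all_reals all_analysis.
From mathcomp Require Import measurable_realfun ring lra.
Import Order.TTheory GRing.Theory Num.Theory.
Import numFieldNormedType.Exports.

Set Implicit Arguments.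
Unset Strict Implicit.
Unset Printing Implicit Defensive.

Local Open Scope classical_set_scope.
Local Open Scope ring_scope.

(** * Euclidean geometry and the descent lemma *)

Section euclidean.
Context (R : realType) (d : nat).
Implicit Types (u v w : 'rV[R]_d) (F : 'rV[R]_d -> R).

Definition dot u v : R := \sum_(i < d) u 0 i * v 0 i.

Lemma dotC u v : dot u v = dot v u.
Proof. by apply: eq_bigr => i _; rewrite mulrC. Qed.

Lemma dotDl u v w : dot (u + v) w = dot u w + dot v w.
Proof. by rewrite -big_split; apply: eq_bigr => i _; rewrite mxE mulrDl. Qed.

Lemma dotZl (a : R) u v : dot (a *: u) v = a * dot u v.
Proof. by rewrite mulr_sumr; apply: eq_bigr => i _; rewrite mxE mulrA. Qed.

Lemma dotNl u v : dot (- u) v = - dot u v.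
Proof. by rewrite -scaleN1r dotZl mulN1r. Qed.

Lemma dotDr u v w : dot u (v + w) = dot u v + dot u w.
Proof. by rewrite dotC dotDl !(dotC u). Qed.

Lemma dotZr (a : R) u v : dot u (a *: v) = a * dot u v.
Proof. by rewrite dotC dotZl dotC. Qed.

Lemma dotNr u v : dot u (- v) = - dot u v.
Proof. by rewrite dotC dotNl dotC. Qed.

Lemma dot_suml I (r : seq I) (P : pred I) (U : I -> 'rV[R]_d) v :
  dot (\sum_(i <- r | P i) U i) v = \sum_(i <- r | P i) dot (U i) v.
Proof.
elim/big_ind2 : _ => [|x a y b <- <-|//]; last by rewrite dotDl.
by rewrite /dot big1// => i _; rewrite mxE mul0r.
Qed.

Lemma dot_sumr I (r : seq I) (P : pred I) u (V : I -> 'rV[R]_d) :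
  dot u (\sum_(i <- r | P i) V i) = \sum_(i <- r | P i) dot u (V i).
Proof. by rewrite dotC dot_suml; under eq_bigr do rewrite dotC. Qed.

Lemma dot_ge0 u : 0 <= dot u u.
Proof. by apply: sumr_ge0 => i _; rewrite -expr2 sqr_ge0. Qed.

Lemma enorm_ge0 u : 0 <= enorm u.
Proof. exact: sqrtr_ge0. Qed.

Lemma sqr_enorm u : enorm u ^+ 2 = dot u u.
Proof.
rewrite /enorm sqr_sqrtr; last by apply: sumr_ge0 => i _; rewrite sqr_ge0.
by apply: eq_bigr => i _; rewrite expr2.
Qed.

Lemma enorm0 : enorm (0 : 'rV[R]_d) = 0.
Proof. by rewrite /enorm big1 ?sqrtr0// => i _; rewrite mxE expr0n. Qed.

Lemma enorm_eq0 u : (enorm u == 0) = (u == 0).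
Proof.
apply/idP/eqP => [|->]; last by rewrite enorm0.
rewrite sqrtr_eq0 => u0; apply/rowP => i; rewrite mxE; apply/eqP.
rewrite -sqrf_eq0 eq_le sqr_ge0 andbT; apply: le_trans u0.
by rewrite (bigD1 i)//= lerDl sumr_ge0// => j _; rewrite sqr_ge0.
Qed.

Lemma enormZ (a : R) u : enorm (a *: u) = `|a| * enorm u.
Proof.
apply/eqP; rewrite -(@eqrXn2 _ 2) ?mulr_ge0 ?enorm_ge0// exprMn !sqr_enorm.
by rewrite dotZl dotZr mulrA -expr2 real_normK ?num_real.
Qed.

(** Cauchy-Schwarz: expanding the square of [enorm v *: u - enorm u *: v] leaves
    [2 * enorm u * enorm v] times the difference of the two sides. Zero vectors are treated first so
    that this factor can be divided out. *)
Lemma ler_dot u v : dot u v <= enorm u * enorm v.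
Proof.
have [->|u0] := eqVneq u 0.
  by rewrite enorm0 mul0r -(scale0r 0) dotZl mul0r.
have [->|v0] := eqVneq v 0.
  by rewrite enorm0 mulr0 -(scale0r 0) dotZr mul0r.
have uv0 : 0 < enorm u * enorm v.
  by rewrite mulr_gt0// lt0r enorm_ge0 enorm_eq0 ?u0 ?v0.
have := dot_ge0 (enorm v *: u - enorm u *: v).
rewrite !(dotDl, dotDr, dotNl, dotNr, dotZl, dotZr) -!sqr_enorm (dotC v u) => h.
rewrite -(ler_pM2l uv0) -subr_ge0 -(pmulr_rge0 _ (ltr0Sn R 1)).
by apply: le_trans h _; rewrite le_eqVlt; apply/orP; left; apply/eqP; ring.
Qed.

Lemma ler_coord_enorm u i : `|u 0 i| <= enorm u.
Proof.
rewrite -(@ler_pXn2r _ 2) ?nnegrE ?enorm_ge0// real_normK ?num_real//.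
rewrite sqr_enorm /dot (bigD1 i)//= -expr2 lerDl sumr_ge0// => j _.
by rewrite -expr2 sqr_ge0.
Qed.

Lemma ler_enormD u v : enorm (u + v) <= enorm u + enorm v.
Proof.
rewrite -(@ler_pXn2r _ 2) ?nnegrE ?addr_ge0 ?enorm_ge0// sqrrD !sqr_enorm.
rewrite dotDl !dotDr (dotC v u).
have := ler_dot u v; lra.
Qed.

Lemma enormN u : enorm (- u) = enorm u.
Proof. by rewrite -scaleN1r enormZ normrN1 mul1r. Qed.

(** Source of the uniform bounds on inner products that integrability and Fubini's theorem require
    below. *)
Lemma ler_norm_dot (u v : 'rV[R]_d) (a b : R) :
  enorm u <= a -> enorm v <= b -> `|dot u v| <= a * b.
Proof.
move=> ua vb; apply: (@le_trans _ _ (enorm u * enorm v)); last first.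
  by rewrite ler_pM ?enorm_ge0.
rewrite ler_norml ler_dot andbT lerNl -dotNl.
by apply: le_trans (ler_dot _ _) _; rewrite enormN.
Qed.

Lemma ler_enorm_sum I (r : seq I) (P : pred I) (U : I -> 'rV[R]_d) :
  enorm (\sum_(i <- r | P i) U i) <= \sum_(i <- r | P i) enorm (U i).
Proof.
elim/big_ind2 : _ => [|x a y b xa yb|//]; first by rewrite enorm0.
exact: le_trans (ler_enormD _ _) (lerD xa yb).
Qed.

(** The differential is linear in the direction, so its value at [v] follows from the partial
    derivatives. *)
Lemma derive_dot_grad F x v : differentiable F x -> 'D_v F x = dot (grad F x) v.
Proof.
move=> dF; rewrite deriveE// {1}[v]row_sum_delta linear_sum.
apply: eq_bigr => i _; rewrite linearZ/= mxE deriveE//.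
exact: mulrC.
Qed.

Lemma is_derive_line F x v (s : R) : differentiable F (x + s *: v) ->
  is_derive s 1 (fun r : R => F (x + r *: v)) (dot (grad F (x + s *: v)) v).
Proof.
move=> dF.
have E : (fun h : R => h^-1 *: ((fun r : R => F (x + r *: v)) (h *: (1 : R) + s)
             - F (x + s *: v))) =
         (fun h : R => h^-1 *: (F (h *: v + (x + s *: v)) - F (x + s *: v))).
  apply/funext => h; congr (_ *: (F _ - _)).
  by rewrite scalerDl addrCA /GRing.scale/= mulr1.
have dv : derivable F (x + s *: v) v by exact: diff_derivable.
split; first by rewrite /derivable [X in X @ _]E.
by rewrite -derive_dot_grad// /derive [X in X @ _]E.
Qed.

(** The mean value theorem on [0, 1] replaces integration along the segment: once the linear and
    quadratic terms are subtracted from [F (x + r *: v)], the derivative of the remainder [phi] is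
    nonpositive at interior points, whence [phi 1 <= phi 0]. *)
Lemma descent_lemma F (L : R) x v : 0 <= L -> L_smooth L F ->
  F (x + v) <= F x + dot (grad F x) v + L / 2 * dot v v.
Proof.
move=> L0 [dF lipF].
pose q (r : R) := F (x + r *: v).
pose c : R := dot (grad F x) v.
pose e : R := L / 2 * dot v v.
pose phi (r : R) := q r - (r * c + r ^+ 2 * e).
pose dphi (r : R) := dot (grad F (x + r *: v)) v - (c + 2 * r * e).
have dphiP (r : R) : is_derive r 1 phi (dphi r).
  have dq : is_derive r 1 q _ := is_derive_line (dF _).
  have dc := is_deriveZ c (is_derive_id r 1).
  have de := is_deriveZ e (is_deriveX 2 (is_derive_id r 1)).
  have dp := is_deriveB dq (is_deriveD dc de).
  move: dp; rewrite [X in is_derive _ _ X](_ : _ = phi) => [dp|].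
    apply: (is_derive_eq dp).
    rewrite /dphi /= -[c *: _]/(c * 1) -[e *: _]/(e * _) -[_ *: 1]/(_ * 1).
    by ring.
  by apply/funext => s; congr (_ - (_ + _)); [|rewrite fctE]; exact: mulrC.
have phiC : {within `[0, 1], continuous phi}.
  by apply: derivable_within_continuous => r _; case: (dphiP r).
have [r /[!in_itv]/= /andP[r0 _]] := MVT ltr01 (fun r _ => dphiP r) phiC.
have -> : phi 1 = F (x + v) - (c + e).
  by rewrite /phi /q scale1r mul1r expr1n mul1r.
have -> : phi 0 = F x by rewrite /phi /q scale0r addr0 mul0r expr0n mul0r; ring.
rewrite subr0 mulr1 => E.
(* The Lipschitz bound at distance [r * enorm v]; the right side is the derivative [2 * r * e] of
   the quadratic term. *)
have : dot (grad F (x + r *: v) - grad F x) v <= L * r * dot v v.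
  apply: le_trans (ler_dot _ _) _; apply: le_trans.
    by apply: ler_wpM2r (lipF _ _); exact: enorm_ge0.
  rewrite addrAC subrr add0r enormZ (ger0_norm (ltW r0)) -sqr_enorm.
  by rewrite expr2 !mulrA.
rewrite dotDl dotNl -/c => h.
have : dphi r <= 0 by rewrite /dphi /e; lra.
by rewrite -E /e; lra.
Qed.

End euclidean.

(** * The Borel sigma-algebra of R^d *)

Section borel_rV.
Context (R : realType) (d : nat).

Lemma continuous_measurable_rV (f : 'rV[R]_d -> R) :
  continuous f -> measurable_fun [set: borelRd R d] (f : borelRd R d -> R).
Proof.
move=> /continuousP cf.
apply: (measurability _ (RGenOpens.measurableE R)) => _ [_ [a [b ->] <-]].
rewrite setTI; apply: sub_sigma_algebra; apply: cf.
exact: interval_open.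
Qed.

Lemma measurable_coord i :
  measurable_fun [set: borelRd R d] (fun v : borelRd R d => (v : 'rV[R]_d) 0 i).
Proof. by apply: continuous_measurable_rV; exact: coord_continuous. Qed.

(** Boxes with rational centres and radii [1/(m+1)] form a countable base of the topology. *)
Let box (c : 'rV[rat]_d * nat) : set 'rV[R]_d :=
  [set v | forall i, `|v 0 i - ratr (c.1 0 i)| < c.2.+1%:R^-1].

Let open_bigcup_box (U : set 'rV[R]_d) : open U ->
  U = \bigcup_(c in [set c | box c `<=` U]) box c.
Proof.
move=> oU; apply/seteqP; split=> [v Uv|v [c cU]]; last exact: cU.
have /nbhs_ballP[e /= e0 eU] : nbhs v U by exact: open_nbhs_nbhs.
(* Half of [e] covers the distance from [v] to the rational centre, the other half the radius of the
   box. *)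
have [n ne] : exists n : nat, n.+1%:R^-1 < e / 2.
  have /ltr_add_invr[n] : 0 < e / 2 by rewrite divr_gt0.
  by rewrite add0r; exists n.
have /choice[q qP] : forall i : 'I_d, exists q : rat,
    `|v 0 i - ratr q| < n.+1%:R^-1.
  move=> i.
  have /rat_in_itvoo[q] : v 0 i < v 0 i + n.+1%:R^-1 by rewrite ltrDl invr_gt0.
  rewrite in_itv/= => /andP[vq qv]; exists q.
  by rewrite distrC gtr0_norm ?subr_gt0// ltrBlDl.
exists (\row_i q i, n) => [w wv /=|i /=]; last by rewrite mxE qP.
apply: eU; split=> // i j; rewrite (ord1 i) /ball/=.
rewrite -(subrKA (ratr (q j))) (le_lt_trans (ler_normD _ _))//.
rewrite (splitr e); apply: ltrD; apply: lt_trans ne; first exact: qP.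
by have := wv j; rewrite /= mxE distrC.
Qed.

(** The preimage of an open set is a countable union of preimages of boxes, each a finite
    intersection of conditions on single coordinates. *)
Lemma measurable_rVP dT (T : measurableType dT) (f : T -> 'rV[R]_d) :
  measurable_fun setT (f : T -> borelRd R d) <->
  forall i, measurable_fun setT (fun t => f t 0 i).
Proof.
split=> [mf i|mf]; first exact: (measurableT_comp (measurable_coord i) mf).
apply: (@measurability _ _ T (borelRd R d) setT f open) => [|_ [U oU <-]]; first by [].
rewrite setTI (open_bigcup_box oU) preimage_bigcup bigcup_mkcond.
apply: countable_bigcupT_measurable => [|c]; first exact: countableP.
case: ifPn => // _; rewrite (_ : _ @^-1` _ = \bigcap_(i in [set: 'I_d])
    ((fun t => `|f t 0 i - ratr (c.1 0 i)|) @^-1` `]-oo, c.2.+1%:R^-1[%classic)).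
  apply: fin_bigcap_measurable => // i _; rewrite -[X in measurable X]setTI.
  have : measurable_fun setT (fun t => `|f t 0 i - ratr (c.1 0 i)|).
    by apply: measurableT_comp => //; exact: measurable_funB.
  by apply => //; exact: measurable_itv.
apply/seteqP; split=> [t ft i _|t ft i]; first by rewrite /= in_itv/=.
by have := ft i I; rewrite /= in_itv.
Qed.

End borel_rV.

(** * Integration against a fresh sample *)

Section bounded_integrals.
Context (R : realType) dT (T : measurableType dT) (mu : probability T R).
Implicit Type f : T -> R.

Lemma bounded_integrable f (M : R) : measurable_fun setT f ->
  (forall t, `|f t| <= M) -> mu.-integrable setT (EFin \o f).
Proof.
move=> mf fM; apply: measurable_bounded_integrable => //.
  by rewrite (le_lt_trans (probability_le1 mu _))// ltry.
exists M; split; first exact: num_real.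
by move=> x Mx t _; apply: le_trans (fM t) (ltW Mx).
Qed.

Lemma Rintegral_EFin f : mu.-integrable setT (EFin \o f) ->
  (\int[mu]_t (f t)%:E = (\int[mu]_t f t)%:E)%E.
Proof. by move=> intf; rewrite /Rintegral fineK//; exact: integrable_fin_num. Qed.

Lemma Rintegral_prob_cst (c : R) : \int[mu]_t c = c.
Proof. by rewrite Rintegral_cst//= probability_setT mulr1. Qed.

Notation integrableR f := (mu.-integrable setT (EFin \o f)).

Lemma integrableR_cst (c : R) : integrableR (fun=> c).
Proof. exact: (@bounded_integrable _ `|c|). Qed.

Lemma integrableRD f g : integrableR f -> integrableR g ->
  integrableR (fun t => f t + g t).
Proof. by move=> intf intg; have := integrableD measurableT intf intg. Qed.

Lemma integrableRB f g : integrableR f -> integrableR g ->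
  integrableR (fun t => f t - g t).
Proof. by move=> intf intg; have := integrableB measurableT intf intg. Qed.

Lemma integrableRZl (c : R) f : integrableR f -> integrableR (fun t => c * f t).
Proof. by move=> intf; have := integrableZl measurableT c intf. Qed.

Lemma integrableRZr (c : R) f : integrableR f -> integrableR (fun t => f t * c).
Proof. by move=> intf; have := integrableZr measurableT c intf. Qed.

Lemma integrableR_sum I (r : seq I) (f : I -> T -> R) :
  (forall i, integrableR (f i)) -> integrableR (fun t => \sum_(i <- r) f i t).
Proof.
move=> intf; have := @integrable_sum _ _ _ mu setT measurableT _ r xpredT _
  (fun i _ => intf i).
by congr (integrable _ _ _); apply/funext => t; rewrite /= sumEFin.
Qed.

Lemma Rintegral_sum I (r : seq I) (f : I -> T -> R) :
  (forall i, integrableR (f i)) ->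
  \int[mu]_t (\sum_(i <- r) f i t) = \sum_(i <- r) \int[mu]_t f i t.
Proof.
move=> intf; elim: r => [|i r IH].
  by under eq_Rintegral do rewrite big_nil; rewrite big_nil Rintegral_prob_cst.
under eq_Rintegral do rewrite big_cons.
by rewrite big_cons -IH RintegralD//; exact: integrableR_sum.
Qed.

End bounded_integrals.

Section independent_pair.
Context (R : realType) dO (Omega : measurableType dO) (P : probability Omega R).
Context dS (S : measurableType dS) dX (Xi : measurableType dX).
Context (D : probability Xi R).

(** Tonelli's theorem gives measurability for the positive and the negative part; [fine] of the
    difference is the real integral. *)
Lemma measurable_Rintegral_snd (f : S * Xi -> R) : measurable_fun setT f ->
  measurable_fun setT (fun s => \int[D]_z f (s, z)).
Proof.
move=> mf; apply: (measurableT_comp (f := fine)) => //.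
have mEf : measurable_fun setT (EFin \o f) by exact/measurable_EFinP.
rewrite (_ : (fun s => _) = (fun s => \int[D]_z ((EFin \o f)^\+ (s, z))%E)%E \-
    (fun s => \int[D]_z ((EFin \o f)^\- (s, z))%E)%E)%E; last first.
  apply/funext => s; rewrite integralE; congr (_ - _)%E; apply: eq_integral.
    by move=> z _; rewrite !funeposE.
  by move=> z _; rewrite !funenegE.
apply: emeasurable_funB; apply: measurable_fun_fubini_tonelli_F => //.
  exact: measurable_funepos.
exact: measurable_funeneg.
Qed.

(** Independence makes the law of the pair [(Y, Z)] the product of the law of [Y] and [D]; Fubini's
    theorem then integrates out [Z] first. *)
Lemma Rintegral_independent (Y : {mfun Omega >-> S}) (Z : {mfun Omega >-> Xi})
    (f : S * Xi -> R) (M : R) :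
  (forall A B, measurable A -> measurable B ->
    P (Y @^-1` A `&` Z @^-1` B) = (P (Y @^-1` A) * D B)%E) ->
  measurable_fun setT f -> (forall u, `|f u| <= M) ->
  \int[P]_w f (Y w, Z w) = \int[P]_w \int[D]_z f (Y w, z).
Proof.
move=> indYZ mf fM.
have mYZ : measurable_fun setT (fun w => (Y w, Z w)).
  exact: measurable_fun_pair.
pose YZ : {mfun Omega >-> (S * Xi)%type} :=
  HB.pack (fun w => (Y w, Z w)) (isMeasurableFun.Build _ _ _ _ _ mYZ).
have mEf : measurable_fun setT (EFin \o f) by exact/measurable_EFinP.
(* Rectangles determine a product measure, and on rectangles the identity is the hypothesis on [Y]
   and [Z]. *)
have jointE (A : set (S * Xi)) : measurable A ->
    (distribution P Y \x D)%E A = distribution P YZ A.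
  apply: product_measure_unique => B C mB mC.
  by rewrite -indYZ//; congr (P _); apply/seteqP; split.
congr fine.
rewrite -(integral_distribution (X := YZ) mEf); last first.
  apply: (bounded_integrable _ (M := M)) => //; exact: measurableT_comp.
rewrite (eq_measure_integral (distribution P Y \x D)%E); last first.
  by move=> A mA _; exact/esym/jointE.
(* The bound [M] keeps the iterated integral of the absolute value finite, as Fubini's theorem
   requires. *)
rewrite -integral12_prod_meas1; last first.
  apply/integrable12ltyP => //.
  apply: (@le_lt_trans _ _ (\int[distribution P Y]_x M%:E)%E).
    apply: ge0_le_integral => //.
    - by move=> s _; exact: integral_ge0.
    - apply: (measurable_fun_fubini_tonelli_F (abse \o (EFin \o f))) ; last first.
        by move=> u; exact: abse_ge0.
      by apply: measurableT_comp => //; exact: measurableT_comp.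
    - move=> s _; apply: (@le_trans _ _ (\int[D]_z M%:E)%E).
        apply: ge0_le_integral => //.
        + apply: measurableT_comp => //; exact/measurable_EFinP/measurable_fun_pair2.
        + by move=> z _; rewrite lee_fin.
      by rewrite integral_cst//= probability_setT mule1.
  by rewrite integral_cst//= probability_setT mule1 ltry.
rewrite -[RHS](integral_distribution (X := Y) (f := fun s => (\int[D]_z f (s, z))%:E)).
- apply: eq_integral => s _; rewrite /fubini_F Rintegral_EFin//.
  by apply: (bounded_integrable _ (M := M)) => //; exact: measurable_fun_pair2.
- exact/measurable_EFinP/measurable_Rintegral_snd.
- apply: (bounded_integrable _ (M := M)).
    by apply: measurableT_comp (measurable_Rintegral_snd mf) _.
  move=> w; apply: le_trans (le_normr_Rintegral _ _) _ => //.
    by apply: (bounded_integrable _ (M := M)) => //; exact: measurable_fun_pair2.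
  rewrite -[leRHS](Rintegral_prob_cst D); apply: le_Rintegral => //.
    apply: (bounded_integrable _ (M := M)) => [|z]; last by rewrite normr_id.
    by apply: measurableT_comp => //; exact: measurable_fun_pair2.
  by apply: (@bounded_integrable _ _ _ _ _ `|M|).
Qed.

End independent_pair.

(** * Sigma-algebras generated by families of samples *)

Section past.
Context (R : realType) dO (Omega : measurableType dO) (P : probability Omega R).
Context dX (Xi : measurableType dX) (I : choiceType).
Context (X : I -> {mfun Omega >-> Xi}).
Implicit Types K : set I.

Definition cylinders K : set (set Omega) :=
  [set E | exists (J : {fset I}) (A : I -> set Xi), [/\ [set` J] `<=` K,
    forall i, measurable (A i) & E = \bigcap_(i in [set` J]) (X i @^-1` A i)]].

(* Omega with the sigma-algebra generated by the [X i], [i] in [K]; the cylinders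
   are stable under intersection, as the pi-lambda theorem requires. *)
Definition past K := g_sigma_algebraType (cylinders K).

Lemma cylinders_setI_closed K : setI_closed (cylinders K).
Proof.
move=> _ _ [J [A [JK mA ->]]] [J' [A' [JK' mA' ->]]].
(* Each family is extended by the full set outside its own index set, so that both can be
   intersected over the union. *)
exists (J `|` J')%fset,
  (fun i => (if i \in J then A i else setT) `&` (if i \in J' then A' i else setT)).
split.
- by move=> i /=; rewrite inE => /orP[/JK|/JK'].
- by move=> i; apply: measurableI; case: ifP.
apply/seteqP; split=> w /=.
  move=> [JA JA'] i /= _; split.
    by case: ifPn => // iJ; exact: JA.
  by case: ifPn => // iJ; exact: JA'.
move=> JJ; split=> i /= iJ.
  by have [] := JJ i; rewrite /= ?inE ?iJ.
by have [] := JJ i; rewrite /= ?inE ?iJ ?orbT.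
Qed.

Lemma cylinders_setT K : cylinders K setT.
Proof.
exists fset0, (fun=> setT); split => //.
by apply/seteqP; split.
Qed.

Lemma cylinders_measurable K : cylinders K `<=` measurable.
Proof.
move=> _ [J [A [_ mA ->]]]; apply: fin_bigcap_measurable => // i _.
by rewrite -[X in measurable X]setTI; exact: measurable_funP.
Qed.

Lemma past_measurable K (E : set Omega) :
  measurable (E : set (past K)) -> measurable E.
Proof.
move=> KE; apply: (smallest_sub _ _ KE); first exact: sigma_algebra_measurable.
exact: cylinders_measurable.
Qed.

Lemma measurable_fun_past K dT (T : measurableType dT) (f : Omega -> T) :
  measurable_fun [set: past K] (f : past K -> T) -> measurable_fun [set: Omega] f.
Proof.
move=> mf _ A mA; apply: (@past_measurable K); exact: mf.
Qed.

(** Lets the identity serve as a random variable with values in [past K], carrying all the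
    information in the samples indexed by [K]. *)
Lemma measurable_past_id K : measurable_fun [set: Omega] (id : Omega -> past K).
Proof. by move=> _ A mA; rewrite setTI; exact: (@past_measurable K). Qed.

Lemma past_sub K K' dT (T : measurableType dT) (f : Omega -> T) : K `<=` K' ->
  measurable_fun [set: past K] (f : past K -> T) ->
  measurable_fun [set: past K'] (f : past K' -> T).
Proof.
move=> KK' mf _ A mA; have := mf measurableT _ mA.
apply: sub_smallest2r; first exact: smallest_sigma_algebra.
move=> _ [J [B [JK mB ->]]].
by exists J, B; split => //; exact: subset_trans KK'.
Qed.

Lemma measurable_past_sample K i : K i ->
  measurable_fun [set: past K] (X i : past K -> Xi).
Proof.
move=> Ki _ A mA; rewrite setTI; apply: sub_sigma_algebra.
exists [fset i]%fset, (fun=> A); split => //.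
  by move=> j /=; rewrite inE => /eqP ->.
apply/seteqP; split=> [w Aw j /=|w]; first by rewrite inE => /eqP ->.
by apply; rewrite /= inE.
Qed.

(** For fixed [B] both sides are finite measures in [E]; by the pi-lambda theorem it suffices to
    compare them on cylinders, where mutual independence applies. *)
Lemma past_independent K0 K i (E : set Omega) (B : set Xi) :
  mutually_independent P K0 X -> K `<=` K0 -> K0 i -> ~ K i ->
  measurable (E : set (past K)) -> measurable B ->
  P (E `&` X i @^-1` B) = (P E * P (X i @^-1` B))%E.
Proof.
move=> indX KK0 K0i Ki mE mB.
have mXB : measurable (X i @^-1` B).
  by rewrite -[Y in measurable Y]setTI; exact: measurable_funP.
have pB0 : 0 <= fine (P (X i @^-1` B)) by exact: fine_ge0.
pose r : {nonneg R} := NngNum pB0.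
have rE : r%:num%:E = P (X i @^-1` B) by rewrite /= fineK ?fin_num_measure.
transitivity (mrestr P mXB E) => //.
have scaleE A : mscale r P A = (P A * P (X i @^-1` B))%E.
  by rewrite muleC -rE.
transitivity (mscale r P E); last exact: scaleE.
apply: (g_sigma_algebra_measure_unique (cylinders K) _ (fun=> setT)) => //.
- exact: cylinders_measurable.
- by move=> _; exact: cylinders_setT.
- by apply/seteqP; split => // w _; exists 0%N.
- exact: cylinders_setI_closed.
- move=> _ [J [A [JK mA ->]]]; rewrite [RHS]scaleE.
  have iJ : i \notin J by apply/negP => /JK.
  (* The intersection of a cylinder over [J] with the event on [X i] is a cylinder over [J] with [i]
     added, described by [A']. Since [i] is not in [J], the old constraints are unchanged. *)
  pose A' j := if j == i then B else A j.
  have A'J j : j \in J -> A' j = A j.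
    by rewrite /A'; case: eqP => // ->; rewrite (negPf iJ).
  transitivity (P (\bigcap_(j in [set` (i |` J)%fset]) (X j @^-1` A' j))).
    congr (P _); apply/seteqP; split=> w /=.
      move=> [JA iB] j /=; rewrite !inE => /orP[/eqP ->|jJ].
        by rewrite /A' eqxx.
      by rewrite A'J//; exact: JA.
    move=> h; split.
      by move=> j /= jJ; rewrite -A'J//; apply: h; rewrite /= !inE jJ orbT.
    by have := h i; rewrite /= !inE eqxx /A' eqxx; exact.
  rewrite indX => [|j /=|j _]; last by rewrite /A'; case: ifP.
    rewrite big_fsetU1//= {1}/A' eqxx muleC; congr (_ * _)%E.
    rewrite indX => [|j /JK /KK0//|//].
    by apply: eq_big_seq => j /A'J ->.
  by rewrite !inE => /orP[/eqP ->//|/JK /KK0].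
- by move=> _; rewrite (le_lt_trans (probability_le1 P _)) ?ltry//; exact: measurableI.
Qed.

(** Takes the place of conditioning on the past: the integrand may involve any function of the
    samples in [K], which stay frozen while the fresh sample is integrated against [D]. *)
Lemma Rintegral_fresh (D : probability Xi R) K0 K i (f : past K * Xi -> R) (M : R) :
  mutually_independent P K0 X -> K `<=` K0 -> K0 i -> ~ K i ->
  (forall A, measurable A -> distribution P (X i) A = D A) ->
  measurable_fun setT f -> (forall u, `|f u| <= M) ->
  \int[P]_w f (w, X i w) = \int[P]_w \int[D]_z f (w, z).
Proof.
move=> indX KK0 K0i Ki XD mf fM.
pose Y : {mfun Omega >-> past K} :=
  HB.pack (id : Omega -> past K)
    (isMeasurableFun.Build _ _ _ _ _ (@measurable_past_id K)).
apply: (@Rintegral_independent _ _ _ _ _ _ _ _ _ Y (X i) f M) => // A B mA mB.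
by rewrite (past_independent indX KK0 K0i Ki)// -XD.
Qed.

End past.

(** * Clipping *)

Section clipping.
Context (R : realType) (d : nat).
Implicit Types (v : 'rV[R]_d) (tau p : R).

(* [clip_factor alpha beta k v *: v] is convertible to
   [clip (alpha * k%:R `^ beta^-1) v]. *)
Definition clip tau v : 'rV[R]_d :=
  (if v == 0 then 1 else Num.min 1 (tau / enorm v)) *: v.

Lemma clip_id tau v : enorm v <= tau -> clip tau v = v.
Proof.
rewrite /clip; case: eqVneq => [->|v0 vtau]; first by rewrite scaler0.
by rewrite min_l ?scale1r// ler_pdivlMr ?mul1r// lt0r enorm_eq0 v0 enorm_ge0.
Qed.

Lemma clip_gt tau v : 0 <= tau -> tau < enorm v -> clip tau v = (tau / enorm v) *: v.
Proof.
move=> tau0 vtau; have v0 : 0 < enorm v by exact: le_lt_trans vtau.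
rewrite /clip -enorm_eq0 gt_eqF// min_r//.
by rewrite ler_pdivrMr// mul1r ltW.
Qed.

Lemma enorm_clip tau v : 0 <= tau -> enorm (clip tau v) = Num.min (enorm v) tau.
Proof.
move=> tau0; have [vtau|vtau] := leP (enorm v) tau; first by rewrite clip_id.
have v0 : 0 < enorm v by exact: le_lt_trans vtau.
by rewrite clip_gt// enormZ ger0_norm ?divr_ge0 ?enorm_ge0// divfK// gt_eqF.
Qed.

Lemma enorm_clip_le tau v : 0 <= tau -> enorm (clip tau v) <= tau.
Proof. by move=> tau0; rewrite enorm_clip// ge_min lexx orbT. Qed.

(** With [r] the clipped norm, [r ^ 2 = r ^ p * r ^ (2 - p)]. Both exponents are nonnegative, so
    [r <= enorm v] bounds the first factor and [r <= tau] the second. *)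
Lemma sqr_enorm_clip_le tau p v : 0 < tau -> 0 < p <= 2 ->
  enorm (clip tau v) ^+ 2 <= enorm v `^ p * tau `^ (2 - p).
Proof.
move=> tau0 /andP[p0 p2]; have tau0' := ltW tau0; rewrite enorm_clip//.
have sqrE r : 0 < r -> r ^+ 2 = r `^ p * r `^ (2 - p).
  move=> r0; rewrite -powRD ?(gt_eqF r0) ?implybT//.
  by rewrite addrC subrK -(powR_mulrn 2)// ltW.
have [vtau|vtau] := leP (enorm v) tau; last first.
  rewrite sqrE//. rewrite ler_wpM2r ?powR_ge0//.
  by apply: ge0_ler_powR; rewrite ?nnegrE ?ltW// (lt_trans tau0).
have [v0|v0] := eqVneq (enorm v) 0.
  by rewrite v0 expr0n mulr_ge0 ?powR_ge0.
rewrite sqrE ?lt0r ?v0 ?enorm_ge0// ler_wpM2l ?powR_ge0//.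
by apply: ge0_ler_powR; rewrite ?nnegrE ?subr_ge0 ?enorm_ge0// ltW.
Qed.

(** Nothing is cut below the threshold. Above it at most [enorm v = enorm v ^ p * enorm v ^ (1 - p)]
    is cut, and the exponent [1 - p] is nonpositive. *)
Lemma enorm_clipB_le tau p v : 0 < tau -> 1 <= p ->
  enorm (clip tau v - v) <= enorm v `^ p * tau `^ (1 - p).
Proof.
move=> tau0 p1; have [vtau|vtau] := leP (enorm v) tau.
  by rewrite clip_id// subrr enorm0 mulr_ge0 ?powR_ge0.
have v0 : 0 < enorm v by exact: lt_trans vtau.
rewrite (clip_gt (ltW tau0) vtau) -{3}[v]scale1r -scalerBl enormZ.
rewrite distrC ger0_norm; last first.
  by rewrite subr_ge0 ler_pdivrMr// mul1r ltW.
apply: (@le_trans _ _ (enorm v)).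
  by rewrite ger_pMl// gerBl divr_ge0// ltW.
rewrite -[leLHS](powRr1 (ltW v0)) -[X in _ `^ X <= _](subrK p) addrC.
rewrite powRD ?(gt_eqF v0) ?implybT// ler_wpM2l ?powR_ge0//.
rewrite -opprB !powRN lef_pV2 ?posrE ?powR_gt0//.
by apply: ge0_ler_powR; rewrite ?nnegrE ?subr_ge0// ltW.
Qed.

End clipping.

(** * Sums of powers of the sample index *)

Section power_sums.
Context (R : realType).

(* Induction on [n], using [(1 - 1/m)^a <= sqrt (1 - 1/m) <= 1 - 1/(2m)]. *)
Lemma sum_powRB1_le (a : R) (n : nat) : 2^-1 <= a ->
  \sum_(1 <= k < n.+1) k%:R `^ (a - 1) <= 2 * n%:R `^ a.
Proof.
move=> a2; elim: n => [|n IH]; first by rewrite big_geq// mulr_ge0 ?powR_ge0.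
rewrite big_nat_recr//=; apply: le_trans (lerD IH (lexx _)) _.
have m0 : 0 < n.+1%:R :> R by rewrite ltr0n.
set m : R := n.+1%:R in m0 *.
(* With [m = n + 1], dividing by [m ^ a] turns the inductive step into
   [2 * (1 - 1/m) ^ a + 1/m <= 2]. *)
have nE : n%:R = m * (1 - m^-1).
  by rewrite mulrBr mulr1 divff ?gt_eqF// /m -natr1 addrK.
have x0 : 0 <= 1 - m^-1.
  by rewrite subr_ge0 invf_le1// /m ler1n.
have x1 : 1 - m^-1 <= 1 by rewrite gerBl invr_ge0 ltW.
have xa : (1 - m^-1) `^ a <= 1 - m^-1 / 2.
  (* The first case is [n = 0]: the base vanishes, and so does its power because [a] is positive. *)
  have [xE|x_neq0] := eqVneq (1 - m^-1) 0.
    rewrite xE powR0 ?gt_eqF ?(lt_le_trans _ a2)//.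
    by move/eqP: xE; rewrite subr_eq0 => /eqP <-; lra.
  apply: (@le_trans _ _ ((1 - m^-1) `^ 2^-1)).
    by apply: ger_powR => //; rewrite lt0r x_neq0 x0.
  move: (m^-1) x0 x1 {x_neq0} => x x0 x1.
  rewrite powR12_sqrt// -(@ler_pXn2r _ 2) ?nnegrE ?sqrtr_ge0//; last by lra.
  by rewrite sqr_sqrtr//; have := sqr_ge0 x; nra.
rewrite nE (powRM _ (ltW m0) x0).
have -> : m `^ (a - 1) = m `^ a * m^-1.
  by rewrite powRB ?(gt_eqF m0) ?implybT// powRr1// ltW.
have ma := powR_ge0 m a.
have := ler_wpM2l ma xa.
by move: (m `^ a) (m^-1) ((1 - m^-1) `^ a) => y x z; lra.
Qed.

Lemma sum_powR_le (b : R) (n : nat) : 0 <= b ->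
  \sum_(1 <= k < n.+1) k%:R `^ b <= n%:R * n%:R `^ b.
Proof.
move=> b0; apply: (@le_trans _ _ (\sum_(1 <= k < n.+1) n%:R `^ b)).
  apply: ler_sum_nat => k /andP[_ kn].
  by apply: ge0_ler_powR; rewrite ?nnegrE// ler_nat.
by rewrite sumr_const_nat subSS subn0 mulr_natl.
Qed.

End power_sums.

(** * Moments of the clipped oracle *)

Section measurable_vectors.
Context (R : realType) (d : nat) dT (T : measurableType dT).
Implicit Types u v : T -> 'rV[R]_d.

(** By [measurable_rVP] this is Borel measurability; coordinates are easier to handle under sums and
    multiples. *)
Definition mcoord v := forall i, measurable_fun setT (fun t => v t 0 i).

Lemma measurable_dot u v : mcoord u -> mcoord v ->
  measurable_fun setT (fun t => dot (u t) (v t)).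
Proof.
by move=> mu mv; apply: measurable_sum => i; exact: measurable_funM.
Qed.

Lemma measurable_enorm v : mcoord v -> measurable_fun setT (fun t => enorm (v t)).
Proof.
move=> mv; apply: (measurableT_comp (f := @Num.sqrt R)).
  by apply: continuous_measurable_fun; exact: sqrt_continuous.
by apply: measurable_sum => i; exact: measurable_funX.
Qed.

Lemma mcoordB u v : mcoord u -> mcoord v -> mcoord (fun t => u t - v t).
Proof.
move=> mu mv i; under eq_fun do rewrite 2!mxE.
exact: measurable_funB.
Qed.

Lemma mcoordZ (c : R) v : mcoord v -> mcoord (fun t => c *: v t).
Proof.
move=> mv i; under eq_fun do rewrite mxE.
exact: measurable_funM.
Qed.

Lemma mcoord_sum I (r : seq I) (v : I -> T -> 'rV[R]_d) :
  (forall j, mcoord (v j)) -> mcoord (fun t => \sum_(j <- r) v j t).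
Proof.
move=> mv i; under eq_fun do rewrite summxE.
by apply: measurable_sum => j; exact: mv.
Qed.

Lemma mcoord_clip (tau : R) v : mcoord v -> mcoord (fun t => clip tau (v t)).
Proof.
move=> mv i.
(* At a zero vector both sides are zero, so the case distinction of [clip] disappears; the inverse
   becomes a power, to which [measurable_powR] applies. *)
rewrite (_ : (fun _ => _) =
  (fun t => Num.min 1 (tau * enorm (v t) `^ (-1)) * v t 0 i)); last first.
  apply/funext => t; rewrite /clip mxE powR_inv1 ?enorm_ge0//.
  by case: eqVneq => // ->; rewrite mxE !mulr0.
apply: measurable_funM => //; apply: measurable_minr => //.
apply: measurable_funM => //.
by apply: (measurableT_comp (measurable_powR _)); exact: measurable_enorm.
Qed.

End measurable_vectors.

(** * Expectations of random vectors *)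

Section vector_mean.
Context (R : realType) (d : nat) dX (Xi : measurableType dX) (D : probability Xi R).
Implicit Types v : Xi -> 'rV[R]_d.

Definition vmean v : 'rV[R]_d := \row_i \int[D]_z v z 0 i.

Definition icoord v := forall i, D.-integrable setT (EFin \o (fun z => v z 0 i)).

Lemma icoordB u v : icoord u -> icoord v -> icoord (fun z => u z - v z).
Proof.
move=> iu iv i; under [in X in integrable _ _ X]eq_fun do rewrite 2!mxE.
exact: integrableRB.
Qed.

Lemma vmeanB u v : icoord u -> icoord v ->
  vmean (fun z => u z - v z) = vmean u - vmean v.
Proof.
move=> iu iv; apply/rowP => i; rewrite !mxE -RintegralB//.
by apply: eq_Rintegral => z _; rewrite 2!mxE.
Qed.

Lemma icoord_bounded v (M : R) : mcoord v -> (forall z, enorm (v z) <= M) -> icoord v.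
Proof.
move=> mv vM i; apply: (@bounded_integrable _ _ _ _ _ M) => // z.
exact: le_trans (ler_coord_enorm _ _) (vM z).
Qed.

Lemma integrable_dotl (c : 'rV[R]_d) v : icoord v ->
  D.-integrable setT (EFin \o (fun z => dot c (v z))).
Proof.
by move=> iv; apply: integrableR_sum => i; exact: integrableRZl.
Qed.

Lemma dot_vmean (c : 'rV[R]_d) v : icoord v ->
  dot c (vmean v) = \int[D]_z dot c (v z).
Proof.
move=> iv; rewrite /dot Rintegral_sum => [|i]; last exact: integrableRZl.
by apply: eq_bigr => i _; rewrite mxE RintegralZl.
Qed.

(** Testing against the mean [m] itself gives [enorm m ^ 2 = E (dot m v) <= enorm m * E h], and a
    nonzero factor [enorm m] cancels. *)
Lemma enorm_vmean_le v (h : Xi -> R) : icoord v ->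
  D.-integrable setT (EFin \o h) -> (forall z, enorm (v z) <= h z) ->
  enorm (vmean v) <= \int[D]_z h z.
Proof.
move=> iv ih vh; have [->|m0] := eqVneq (vmean v) 0.
  by rewrite enorm0 Rintegral_ge0// => z _; exact: le_trans (enorm_ge0 _) (vh z).
have {m0} : 0 < enorm (vmean v) by rewrite lt0r enorm_eq0 m0 enorm_ge0.
set m := vmean v => m0; rewrite -(ler_pM2l m0) -expr2 sqr_enorm dot_vmean//.
rewrite -RintegralZl//; apply: le_Rintegral => //.
- exact: integrable_dotl.
- exact: integrableRZl.
- move=> z _; apply: le_trans (ler_dot _ _) _.
  by rewrite ler_wpM2l ?enorm_ge0.
Qed.

End vector_mean.

Section clipped_oracle.
Context (R : realType) (d : nat) dX (Xi : measurableType dX) (D : probability Xi R).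
Variables (g : Xi -> 'rV[R]_d) (f : 'rV[R]_d) (p sigma : R).
Hypotheses (p1 : 1 < p) (p2 : p <= 2) (sigma0 : 0 < sigma) (mg : mcoord g).
Hypothesis (mean : forall i, ('E_D[fun z => (g z 0 i)%R] = (f 0 i)%R%:E)%E).
Hypothesis (moment : ('E_D[fun z => (enorm (g z) `^ p)%R] <= (sigma `^ p)%R%:E)%E).

Let mgp : measurable_fun setT (fun z => enorm (g z) `^ p).
Proof.
by apply: (measurableT_comp (measurable_powR _)); exact: measurable_enorm.
Qed.

Lemma integrable_moment :
  D.-integrable setT (EFin \o (fun z => enorm (g z) `^ p)).
Proof.
apply/integrableP; split; first exact/measurable_EFinP.
apply: le_lt_trans (ltry (sigma `^ p)); apply: le_trans moment.
rewrite unlock le_eqVlt; apply/orP; left; apply/eqP; apply: eq_integral => z _.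
by rewrite /= ger0_norm ?powR_ge0.
Qed.

Lemma Rintegral_moment_le : \int[D]_z enorm (g z) `^ p <= sigma `^ p.
Proof.
rewrite -lee_fin -Rintegral_EFin; last exact: integrable_moment.
by move: moment; rewrite unlock.
Qed.

(** An integrable majorant of the norm, as [r <= 1 + r ^ p] for [p >= 1]; it turns the moment bound
    into integrability of the oracle. *)
Let h z := 1 + enorm (g z) `^ p.

Let ih : D.-integrable setT (EFin \o h).
Proof. exact: integrableRD (integrableR_cst _ _) integrable_moment. Qed.

Let gh z : enorm (g z) <= h z.
Proof.
rewrite /h; have [g1|g1] := leP (enorm (g z)) 1.
  by apply: le_trans g1 _; rewrite lerDl powR_ge0.
apply: (@le_trans _ _ (enorm (g z) `^ p)); last by rewrite lerDr ler01.
by apply: le1r_powR; rewrite ltW.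
Qed.

Lemma icoord_oracle : icoord D g.
Proof.
move=> i; apply: (le_integrable _ _ _ ih) => //; first exact/measurable_EFinP.
move=> z _; rewrite lee_fin; apply: le_trans (ler_coord_enorm _ _) _.
exact: le_trans (gh z) (ler_norm _).
Qed.

Lemma vmean_oracle : vmean D g = f.
Proof.
apply/rowP => i; rewrite mxE; apply/EFin_inj; rewrite -mean unlock.
by rewrite Rintegral_EFin//; exact: icoord_oracle.
Qed.

(** Uniform in the point, this bound will keep the deviations bounded; its crude constant does not
    reach the final estimate. *)
Lemma enorm_mean_le : enorm f <= 1 + sigma `^ p.
Proof.
rewrite -vmean_oracle; apply: le_trans (enorm_vmean_le icoord_oracle ih gh) _.
rewrite /h RintegralD//; last exact: integrable_moment.
  by rewrite Rintegral_prob_cst lerD2l Rintegral_moment_le.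
exact: integrableR_cst.
Qed.

Variables (tau : R) (tau0 : 0 < tau).

Let u z := clip tau (g z).

Let mu : mcoord u. Proof. exact: mcoord_clip. Qed.

Let utau z : enorm (u z) <= tau.
Proof. by apply: enorm_clip_le; exact: ltW. Qed.

Let iu : icoord D u. Proof. exact: icoord_bounded utau. Qed.

(** As the oracle is unbiased, the bias is the mean of [u - g], which [enorm_clipB_le] bounds
    pointwise. *)
Lemma clip_bias_le : enorm (vmean D u - f) <= sigma `^ p * tau `^ (1 - p).
Proof.
rewrite -vmean_oracle -vmeanB//; last exact: icoord_oracle.
apply: (@le_trans _ _ (\int[D]_z (enorm (g z) `^ p * tau `^ (1 - p)))).
  apply: enorm_vmean_le; first exact: (icoordB iu icoord_oracle).
    by apply: integrableRZr; exact: integrable_moment.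
  by move=> z; apply: enorm_clipB_le => //; exact: ltW.
rewrite RintegralZr//; last exact: integrable_moment.
by rewrite ler_wpM2r ?powR_ge0// Rintegral_moment_le.
Qed.

(** With [m] the mean of [u], the left side equals [E |u|^2 - |m|^2 + |m - f|^2]. The middle term is
    dropped; the outer ones are the clipped second moment and the squared bias. *)
Lemma clip_second_moment_le :
  \int[D]_z dot (u z - f) (u z - f) <=
  sigma `^ p * tau `^ (2 - p) + (sigma `^ p * tau `^ (1 - p)) ^+ 2.
Proof.
have iuu : D.-integrable setT (EFin \o (fun z => dot (u z) (u z))).
  apply: (@bounded_integrable _ _ _ _ _ (tau ^+ 2)) => [|z].
    exact: measurable_dot.
  rewrite ger0_norm ?dot_ge0// -sqr_enorm.
  by rewrite ler_pXn2r ?nnegrE ?enorm_ge0// ltW.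
have ifu : D.-integrable setT (EFin \o (fun z => dot ((-2) *: f) (u z))).
  exact: integrable_dotl.
have uuE : \int[D]_z dot (u z - f) (u z - f) =
    \int[D]_z dot (u z) (u z) - 2 * dot f (vmean D u) + dot f f.
  rewrite -mulNr -dotZl dot_vmean// -[X in _ = _ + X](Rintegral_prob_cst D).
  rewrite -RintegralD// -RintegralD//; last first.
  - exact: integrableR_cst.
  - exact: integrableRD.
  - apply: eq_Rintegral => z _.
    by rewrite (dotZl (-2) f) dotDl !dotDr !dotNl !dotNr (dotC (u z) f); ring.
have uu_le : \int[D]_z dot (u z) (u z) <= sigma `^ p * tau `^ (2 - p).
  apply: (@le_trans _ _ (\int[D]_z (enorm (g z) `^ p * tau `^ (2 - p)))).
    apply: le_Rintegral => //.
      by apply: integrableRZr; exact: integrable_moment.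
    move=> z _; rewrite -sqr_enorm; apply: sqr_enorm_clip_le => //.
    by rewrite p2 (lt_trans ltr01).
  rewrite RintegralZr//; last exact: integrable_moment.
  by rewrite ler_wpM2r ?powR_ge0// Rintegral_moment_le.
have b_le : dot (vmean D u - f) (vmean D u - f) <= (sigma `^ p * tau `^ (1 - p)) ^+ 2.
  by rewrite -sqr_enorm ler_pXn2r ?nnegrE ?enorm_ge0 ?mulr_ge0 ?powR_ge0// clip_bias_le.
have := dot_ge0 (vmean D u).
move: b_le; rewrite dotDl !dotDr !dotNl !dotNr (dotC (vmean D u) f) uuE; lra.
Qed.

End clipped_oracle.

(** * Deviations within a batch *)

Section fresh_samples.
Context (R : realType) (d : nat) dO (Omega : measurableType dO)
  (P : probability Omega R) dX (Xi : measurableType dX) (D : probability Xi R)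
  (I : choiceType) (X : I -> {mfun Omega >-> Xi}).
Variables (g : 'rV[R]_d -> Xi -> 'rV[R]_d) (F : 'rV[R]_d -> R) (p sigma : R).
Hypotheses (p1 : 1 < p) (p2 : p <= 2) (sigma0 : 0 < sigma).
Hypotheses (mg : measurable_oracle g)
  (mgF : forall i, measurable_fun [set: borelRd R d]
     (fun y : borelRd R d => grad F y 0 i))
  (mean : unbiased D F g) (moment : bounded_moment D p sigma g).
Variable K0 : set I.
Hypothesis indX : mutually_independent P K0 X.
Hypothesis XD : forall i, K0 i -> forall A, measurable A ->
  distribution P (X i) A = D A.

Lemma mcoord_oracle dS (S : measurableType dS) (Y : S -> 'rV[R]_d) (Z : S -> Xi) :
  measurable_fun setT (Y : S -> borelRd R d) -> measurable_fun setT Z ->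
  mcoord (fun s => g (Y s) (Z s)).
Proof.
move=> mY mZ; apply/measurable_rVP.
exact: (measurableT_comp mg (measurable_fun_pair mY mZ)).
Qed.

Let mgx y : mcoord (g y).
Proof. exact: (mcoord_oracle (Y := fun=> y) (Z := id)). Qed.

Lemma mcoord_grad dS (S : measurableType dS) (Y : S -> 'rV[R]_d) :
  measurable_fun setT (Y : S -> borelRd R d) -> mcoord (fun s => grad F (Y s)).
Proof. by move=> mY i; apply: (measurableT_comp (mgF i)). Qed.

Let C := 1 + sigma `^ p.

Let grad_le y : enorm (grad F y) <= C.
Proof. exact: (enorm_mean_le p1 (mgx y) (mean y) (moment y)). Qed.

Definition dev (tau : R) (y : 'rV[R]_d) (z : Xi) := clip tau (g y z) - grad F y.

(** The mean of [dev tau y] over a fresh sample. *)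
Definition bias (tau : R) (y : 'rV[R]_d) :=
  vmean D (fun z => clip tau (g y z)) - grad F y.

Let bound (tau : R) := sigma `^ p * tau `^ (1 - p).

Lemma mcoord_dev tau dS (S : measurableType dS) (Y : S -> 'rV[R]_d) (Z : S -> Xi) :
  measurable_fun setT (Y : S -> borelRd R d) -> measurable_fun setT Z ->
  mcoord (fun s => dev tau (Y s) (Z s)).
Proof.
move=> mY mZ; apply: mcoordB; last exact: mcoord_grad.
by apply: mcoord_clip; exact: mcoord_oracle.
Qed.

Let mcoord_bias tau dS (S : measurableType dS) (Y : S -> 'rV[R]_d) :
  measurable_fun setT (Y : S -> borelRd R d) -> mcoord (fun s => bias tau (Y s)).
Proof.
move=> mY; apply: mcoordB; last exact: mcoord_grad.
move=> i; under eq_fun do rewrite mxE.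
apply: (measurable_Rintegral_snd D (f := fun u => clip tau (g (Y u.1) u.2) 0 i)).
apply: (mcoord_clip tau (v := fun u : S * Xi => g (Y u.1) u.2)).
by apply: mcoord_oracle; [exact: measurableT_comp mY _|].
Qed.

Lemma enorm_dev_le tau y z : 0 < tau -> enorm (dev tau y z) <= tau + C.
Proof.
move=> tau0; apply: le_trans (ler_enormD _ _) _.
by rewrite enormN lerD// enorm_clip_le// ltW.
Qed.

Let bias_le tau y : 0 < tau -> enorm (bias tau y) <= bound tau.
Proof.
move=> tau0.
exact: (clip_bias_le p1 (mgx y) (mean y) (moment y) tau0).
Qed.

Let Rintegral_dot_dev tau (c y : 'rV[R]_d) : 0 < tau ->
  \int[D]_z dot c (dev tau y z) = dot c (bias tau y).
Proof.
move=> tau0.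
have iu : icoord D (fun z => clip tau (g y z)).
  apply: (@icoord_bounded _ _ _ _ _ _ tau); first exact: mcoord_clip.
  by move=> z; apply: enorm_clip_le; exact: ltW.
have ic : icoord D (fun=> grad F y) by move=> i; exact: integrableR_cst.
rewrite -dot_vmean; last exact: icoordB.
rewrite vmeanB//; congr (dot c (_ - _)).
by apply/rowP => i; rewrite mxE Rintegral_prob_cst.
Qed.

Variables (K : set I) (Y : Omega -> 'rV[R]_d).
Hypothesis KK0 : K `<=` K0.
Hypothesis mY : measurable_fun [set: past X K] (Y : past X K -> borelRd R d).

(** [Y] is determined by the samples in [K], so it stays frozen while the fresh [X i] is integrated
    out; [clip_second_moment_le] then applies at each value of [Y]. *)
Lemma Rintegral_dev_sqr_le i tau : K0 i -> ~ K i -> 0 < tau ->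
  \int[P]_w dot (dev tau (Y w) (X i w)) (dev tau (Y w) (X i w)) <=
  sigma `^ p * tau `^ (2 - p) + bound tau ^+ 2.
Proof.
move=> K0i Ki tau0.
pose f (u : past X K * Xi) := dot (dev tau (Y u.1) u.2) (dev tau (Y u.1) u.2).
have md : mcoord (fun u : past X K * Xi => dev tau (Y u.1) u.2).
  by apply: mcoord_dev; [exact: measurableT_comp mY _|].
have mf : measurable_fun setT f by exact: measurable_dot.
have fM u : `|f u| <= (tau + C) * (tau + C).
  by apply: ler_norm_dot; exact: enorm_dev_le.
rewrite (Rintegral_fresh (f := f) indX KK0 K0i Ki (XD K0i) mf fM).
rewrite -[leRHS](Rintegral_prob_cst P); apply: le_Rintegral => //.
- apply: (bounded_integrable _ (M := (tau + C) * (tau + C))).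
    exact: (measurable_fun_past (measurable_Rintegral_snd D mf)).
  move=> w; apply: le_trans (le_normr_Rintegral _ _) _ => //.
    apply: (bounded_integrable _ (M := (tau + C) * (tau + C))) => [|z].
      exact: (measurable_fun_pair2 (w : past X K) mf).
    exact: fM.
  rewrite -[leRHS](Rintegral_prob_cst D); apply: le_Rintegral => //.
  + apply: (bounded_integrable _ (M := (tau + C) * (tau + C))) => [|z].
      by apply: measurableT_comp => //; exact: (measurable_fun_pair2 (w : past X K) mf).
    by rewrite normr_id; exact: fM.
  + exact: integrableR_cst.
- exact: integrableR_cst.
- move=> w _.
  exact: (clip_second_moment_le p1 p2 (mgx (Y w)) (mean _) (moment _) tau0).
Qed.

(* Integrating out [X j] first turns its deviation into a bias, which is a function
   of the past; integrating out [X i] then leaves a product of two biases. *)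
Lemma Rintegral_dev_cross_le i j (s t : R) : K0 i -> K0 j -> i != j ->
    ~ K i -> ~ K j -> 0 < s -> 0 < t ->
  \int[P]_w dot (dev s (Y w) (X i w)) (dev t (Y w) (X j w)) <= bound s * bound t.
Proof.
move=> K0i K0j ij Ki Kj s0 t0.
(* Enlarging the past by [i] makes the deviation of [X i] a function of it, while [X j] stays
   fresh. *)
pose K' := K `|` [set i].
have KK' : K `<=` K' by move=> k; left.
have K'K0 : K' `<=` K0 by move=> k [/KK0//|->].
have K'j : ~ K' j by move=> [//|/= ji]; rewrite ji eqxx in ij.
have mY' : measurable_fun [set: past X K'] (Y : past X K' -> borelRd R d).
  exact: past_sub mY.
pose f' (u : past X K' * Xi) := dot (dev s (Y u.1) (X i u.1)) (dev t (Y u.1) u.2).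
have mXi : measurable_fun [set: past X K'] (X i : past X K' -> Xi).
  by apply: measurable_past_sample; right.
have mf' : measurable_fun setT f'.
  apply: measurable_dot.
    apply: (mcoord_dev s (S := (past X K' * Xi)%type) (Z := fun u => X i u.1)).
      exact: measurableT_comp mY' _.
    exact: measurableT_comp mXi _.
  by apply: mcoord_dev; [exact: measurableT_comp mY' _|].
have f'M u : `|f' u| <= (s + C) * (t + C).
  by apply: ler_norm_dot; exact: enorm_dev_le.
rewrite (Rintegral_fresh (f := f') indX K'K0 K0j K'j (XD K0j) mf' f'M).
have f'E w : \int[D]_z f' (w, z) = dot (dev s (Y w) (X i w)) (bias t (Y w)).
  exact: (Rintegral_dot_dev (dev s (Y w) (X i w)) (Y w) t0).
under eq_Rintegral do rewrite f'E.
pose f (u : past X K * Xi) := dot (dev s (Y u.1) u.2) (bias t (Y u.1)).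
have mf : measurable_fun setT f.
  apply: measurable_dot.
    by apply: mcoord_dev; [exact: measurableT_comp mY _|].
  by apply: mcoord_bias; exact: measurableT_comp mY _.
have fM u : `|f u| <= (s + C) * bound t.
  by apply: ler_norm_dot; [exact: enorm_dev_le|exact: bias_le].
rewrite (Rintegral_fresh (f := f) indX KK0 K0i Ki (XD K0i) mf fM).
rewrite -[leRHS](Rintegral_prob_cst P).
have fE w : \int[D]_z f (w, z) = dot (bias s (Y w)) (bias t (Y w)).
  by rewrite dotC -Rintegral_dot_dev//; apply: eq_Rintegral => z _; rewrite dotC.
under eq_Rintegral do rewrite fE.
apply: le_Rintegral => //.
- apply: (bounded_integrable _ (M := bound s * bound t)) => [|w].
    by apply: measurable_dot; apply: mcoord_bias; exact: measurable_fun_past mY.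
  by apply: ler_norm_dot; exact: bias_le.
- exact: integrableR_cst.
- move=> w _; apply: le_trans (ler_norm _) _.
  by apply: ler_norm_dot; exact: bias_le.
Qed.

End fresh_samples.

(** * The iterates *)

Section smooth.
Context (R : realType) (d : nat).
Implicit Types (F : 'rV[R]_d -> R) (v : 'rV[R]_d).

(** Compares [enorm] with the sup norm that defines the topology; the factor [d] comes from the
    triangle inequality over the basis expansion. *)
Lemma enorm_le_coord v (e : R) : 0 <= e -> (forall i, `|v 0 i| <= e) ->
  enorm v <= d%:R * e.
Proof.
move=> e0 ve; rewrite [v]row_sum_delta; apply: le_trans (ler_enorm_sum _ _ _) _.
rewrite mulr_natl -[X in _ *+ X]card_ord -sumr_const.
apply: ler_sum => i _; rewrite enormZ.
rewrite (_ : enorm _ = 1) ?mulr1//.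
rewrite /enorm (bigD1 i)//= big1 => [|j ji]; last first.
  by rewrite mxE (negPf ji) andbF expr0n.
by rewrite mxE !eqxx expr1n addr0 sqrtr1.
Qed.

Lemma continuous_grad F (L : R) i : 0 < L -> L_smooth L F ->
  continuous (fun y => grad F y 0 i).
Proof.
move=> L0 [_ lipF] y; apply/(@cvgrPdist_le _ _ _ _ (nbhs_filter y)) => e e0.
apply/nbhs_ballP.
have Ld0 : 0 < L * d%:R + 1 by rewrite ltr_wpDl// mulr_ge0// ltW.
(* The added 1 keeps the denominator positive even for [d = 0]. *)
exists (e / (L * d%:R + 1)) => [|z [_ yz]]; first by rewrite /= divr_gt0.
have -> : grad F y 0 i - grad F z 0 i = (grad F y - grad F z) 0 i.
  by rewrite [RHS]mxE [X in _ = _ + X]mxE.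
apply: le_trans (ler_coord_enorm _ _) _; apply: le_trans (lipF _ _) _.
have e'0 : 0 <= e / (L * d%:R + 1) by rewrite divr_ge0 ?ltW.
apply: (@le_trans _ _ (L * (d%:R * (e / (L * d%:R + 1))))).
  rewrite ler_pM2l//; apply: enorm_le_coord => // j.
  by rewrite 2!mxE; exact/ltW/(yz 0 j).
rewrite !mulrA ler_pdivrMr// mulrDr mulr1 mulrC lerDl ltW//.
Qed.

(* [eta * L <= 1] absorbs the quadratic term, after which completing the square
   turns the inner product into the gradient error [z]. *)
Lemma gradient_step_le F (L eta : R) y z : 0 <= L -> L_smooth L F ->
  0 <= eta -> eta * L <= 1 ->
  F (y - eta *: (grad F y + z)) <=
  F y + eta / 2 * (enorm z ^+ 2 - enorm (grad F y) ^+ 2).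
Proof.
move=> L0 smF eta0 etaL; rewrite !sqr_enorm.
have := descent_lemma y (- (eta *: (grad F y + z))) L0 smF.
move/le_trans; apply; rewrite dotNr dotNl dotNr opprK dotZl !dotZr.
rewrite !(dotDl, dotDr) (dotC z).
set a := dot (grad F y) (grad F y); set b := dot (grad F y) z; set c := dot z z.
have abc : 0 <= a + b + (b + c).
  by have := dot_ge0 (grad F y + z); rewrite dotDl !dotDr (dotC z).
have : eta * L * (eta * (a + b + (b + c))) <= 1 * (eta * (a + b + (b + c))).
  by apply: ler_wpM2r => //; exact: mulr_ge0.
move=> h; lra.
Qed.

End smooth.

Section clip_levels.
Context (R : realType) (p sigma : R).
Hypotheses (p0 : 0 < p) (sigma0 : 0 < sigma).

(** Evaluates both clipping bounds at the thresholds of the algorithm: [q = 1] gives the bias and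
    [q = 2] the second moment. *)
Lemma clip_levelM (k : nat) (q : R) : (0 < k)%N ->
  sigma `^ p * (sigma * k%:R `^ p^-1) `^ (q - p) = sigma `^ q * k%:R `^ (q / p - 1).
Proof.
move=> k0; rewrite powRM ?powR_ge0 ?(ltW sigma0)// mulrA -powRD; last first.
  by rewrite (gt_eqF sigma0) implybT.
rewrite -powRrM mulrBr mulVf ?gt_eqF// (mulrC _ q).
by rewrite addrC subrK.
Qed.

End clip_levels.

(** * Noise bound and telescoping along a run of the algorithm *)

Section ps_clip_sgd_iterates.
Context (R : realType) (d : nat) (F : 'rV[R]_d -> R) (L Fstar : R).
Hypotheses (L0 : 0 < L) (smF : L_smooth L F) (hFstar : forall y, Fstar <= F y).
Context dX (Xi : measurableType dX) (D : probability Xi R).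
Variable g : 'rV[R]_d -> Xi -> 'rV[R]_d.
Hypothesis mg : measurable_oracle g.
Variables (p sigma : R).
Hypotheses (p1 : 1 < p) (p2 : p <= 2) (sigma0 : 0 < sigma).
Hypotheses (mean : unbiased D F g) (moment : bounded_moment D p sigma g).
Variables (T n : nat) (x1 : 'rV[R]_d) (eta : nat -> R).
Hypotheses (n0 : (0 < n)%N).
Hypothesis eta_bnd : forall t : nat, (1 <= t <= T)%N -> 0 < eta t < L^-1.
Context dO (Omega : measurableType dO) (P : probability Omega R).
Variable xi : nat -> nat -> {mfun Omega >-> Xi}.
Hypothesis iid : iid_samples P D T n xi.
Variable x : nat -> Omega -> 'rV[R]_d.
Hypothesis sgd :
  ps_clip_sgd g sigma p n T eta (fun t k => xi t k : Omega -> Xi) x1 x.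

Let X (tk : nat * nat) := xi tk.1 tk.2.
Let K0 := [set tk : nat * nat | (1 <= tk.1 <= T)%N /\ (1 <= tk.2 <= n)%N].
(** The samples drawn strictly before iteration [t], on which [x t] depends. *)
Let K (t : nat) := [set tk : nat * nat | (1 <= tk.1 < t)%N /\ (1 <= tk.2 <= n)%N].
(** Ordinals count from 0, so [k] stands for sample [k.+1]. *)
Let tau (k : 'I_n) := sigma * k.+1%:R `^ p^-1.
Let a t (k : 'I_n) w := dev g F (tau k) (x t w) (xi t k.+1 w).
(** The gradient error: by [stepE] each step moves along [grad F + Z]. *)
Let Z t w := n%:R^-1 *: \sum_(k < n) a t k w.

Let tau_gt0 k : 0 < tau k.
Proof. by rewrite mulr_gt0// powR_gt0. Qed.

Let n_gt0 : 0 < n%:R :> R. Proof. by rewrite ltr0n. Qed.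

Let mgF i : measurable_fun [set: borelRd R d] (fun y : borelRd R d => grad F y 0 i).
Proof. by apply: continuous_measurable_rV; exact: continuous_grad L0 smF. Qed.

Let mF : measurable_fun [set: borelRd R d] (F : borelRd R d -> R).
Proof.
apply: continuous_measurable_rV => y; apply: differentiable_continuous.
exact: smF.1.
Qed.

Let gradientE t w : clipped_gradient g sigma p n (x t w) (fun k => xi t k w) =
  n%:R^-1 *: \sum_(k < n) clip (tau k) (g (x t w) (xi t k.+1 w)).
Proof. by rewrite /clipped_gradient big_add1 big_mkord. Qed.

Let stepE t w : (1 <= t <= T)%N ->
  x t.+1 w = x t w - eta t *: (grad F (x t w) + Z t w).
Proof.
move=> tT; rewrite sgd.2// gradientE; congr (_ - _ *: _).
rewrite /Z /a /dev sumrB sumr_const card_ord scalerBr -[grad F _ *+ n]scaler_nat scalerA.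
by rewrite mulVf ?gt_eqF// scale1r addrC subrK.
Qed.

(** By induction: an update brings in only the samples of its own batch. Hence batch [t] is fresh
    relative to [x t]. The range reaches [T.+1] because telescoping ends there. *)
Lemma measurable_iterate t : (1 <= t <= T.+1)%N ->
  measurable_fun [set: past X (K t)] (x t : past X (K t) -> borelRd R d).
Proof.
elim: t => // -[_ _|t IH /andP[_ tT]].
  rewrite (_ : x 1%N = fun=> x1); first exact: measurable_cst.
  by apply/funext => w; exact: sgd.1.
have {}tT : (1 <= t.+1 <= T)%N by [].
have KS : K t.+1 `<=` K t.+2.
  by move=> tk [/andP[h1 h2] h3]; split=> //; rewrite h1 ltnW.
have mxt : measurable_fun [set: past X (K t.+2)]
    (x t.+1 : past X (K t.+2) -> borelRd R d).
  by apply: (past_sub KS); apply: IH; case/andP: tT => _ /leqW ->.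
have mxi (k : 'I_n) : measurable_fun [set: past X (K t.+2)]
    (xi t.+1 k.+1 : past X (K t.+2) -> Xi).
  apply: (@measurable_past_sample _ _ _ _ _ X (K t.+2) (t.+1, k.+1)).
  by split; rewrite /= ?ltnSn.
rewrite (_ : x t.+2 = fun w => x t.+1 w - eta t.+1 *:
    (n%:R^-1 *: \sum_(k < n) clip (tau k) (g (x t.+1 w) (xi t.+1 k.+1 w)))); last first.
  by apply/funext => w; rewrite sgd.2// gradientE.
apply/measurable_rVP.
apply: (@mcoordB _ _ _ (past X (K t.+2))); first exact/measurable_rVP.
apply: mcoordZ; apply: mcoordZ; apply: mcoord_sum => k.
apply: mcoord_clip; apply: (@mcoord_oracle _ _ _ _ _ mg _ (past X (K t.+2))) => //.
Qed.

Let mx t : (1 <= t <= T.+1)%N ->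
  measurable_fun [set: Omega] (x t : Omega -> borelRd R d).
Proof. by move=> tT; apply: measurable_fun_past (measurable_iterate tT). Qed.

Let ltT t : (1 <= t <= T)%N -> (1 <= t <= T.+1)%N.
Proof. by move=> /andP[-> /leqW ->]. Qed.

Let ma t k : (1 <= t <= T)%N -> mcoord (a t k).
Proof. by move=> tT; apply: (mcoord_dev mg mgF) => //; exact/mx/ltT. Qed.

Let B := \sum_(k < n) (tau k + (1 + sigma `^ p)).

Let a_le t k w : enorm (a t k w) <= tau k + (1 + sigma `^ p).
Proof. exact: (enorm_dev_le p1 mg mean moment). Qed.

Let Z_le t w : enorm (Z t w) <= B.
Proof.
rewrite enormZ ger0_norm ?invr_ge0 ?ler0n//.
apply: (@le_trans _ _ (enorm (\sum_(k < n) a t k w))).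
  by rewrite ler_piMl ?enorm_ge0// invf_le1// ler1n.
by apply: le_trans (ler_enorm_sum _ _ _) _; apply: ler_sum => k _.
Qed.

Let step_le t w : (1 <= t <= T)%N -> F (x t.+1 w) <=
  F (x t w) + eta t / 2 * (enorm (Z t w) ^+ 2 - enorm (grad F (x t w)) ^+ 2).
Proof.
move=> tT; have /andP[eta0 etaL] := eta_bnd tT; rewrite stepE//.
apply: gradient_step_le smF _ _; [exact: ltW|exact: ltW|].
by rewrite -ler_pdivlMr// mul1r ltW.
Qed.

(** Each step raises [F] by at most [eta t / 2 * B ^ 2], which bounds it above along a finite run;
    [Fstar] bounds it below. *)
Let F_bounded t : (1 <= t <= T.+1)%N -> exists M, forall w, `|F (x t w)| <= M.
Proof.
move=> tT; suff [M FM] : exists M, forall w, F (x t w) <= M.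
  exists (`|M| + `|Fstar|) => w; rewrite ler_norml; apply/andP; split.
    rewrite opprD; apply: le_trans (hFstar _).
    have := ler_norm (- Fstar); rewrite normrN => h.
    have := normr_ge0 M; lra.
  apply: le_trans (FM w) _; apply: le_trans (ler_norm _) _.
  by rewrite lerDl.
elim: t tT => // -[_ _|t IH /andP[_ tT]].
  by exists (F x1) => w; rewrite sgd.1.
have {}tT : (1 <= t.+1 <= T)%N by [].
have [M FM] := IH (ltT tT).
have /andP[eta0 _] := eta_bnd tT.
exists (M + eta t.+1 / 2 * B ^+ 2) => w.
apply: le_trans (step_le w tT) _; apply: lerD => //.
apply: ler_wpM2l; first by rewrite divr_ge0// ltW.
apply: (@le_trans _ _ (enorm (Z t.+1 w) ^+ 2)); first by rewrite gerBl sqr_ge0.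
by rewrite ler_pXn2r ?nnegrE ?enorm_ge0// (le_trans (enorm_ge0 _) (Z_le t.+1 w)).
Qed.

(** The constant is [4 + 1]: the squared sum of the biases contributes 4, the second moments 1. *)
Let W := 5 * sigma ^+ 2 * n%:R `^ (- (2 * (p - 1) / p)).

(** Bias bound for sample [k.+1], not the parameter [beta] of the algorithm, which is [p] here. *)
Let beta (k : 'I_n) := sigma * k.+1%:R `^ (p^-1 - 1).
Let nu (k : 'I_n) := sigma ^+ 2 * k.+1%:R `^ (2 / p - 1).

Let p_gt0 : 0 < p. Proof. exact: lt_trans p1. Qed.

Let biasE k : sigma `^ p * tau k `^ (1 - p) = beta k.
Proof. by rewrite clip_levelM// powRr1 ?ltW// div1r. Qed.

Let varE k : sigma `^ p * tau k `^ (2 - p) = nu k.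
Proof. by rewrite clip_levelM// powR_mulrn// ltW. Qed.

(** The sums are estimated with [a = 1/p], at least 1/2 because [p <= 2], and with [b = 2/p - 1];
    the squared first sum and the second are both of order [n ^ (2/p)]. *)
Let sum_noise_le : n%:R^-1 ^+ 2 * ((\sum_k beta k) ^+ 2 + \sum_k nu k) <= W.
Proof.
have half_pV : 2^-1 <= p^-1 by rewrite lef_pV2 ?posrE.
have sb : \sum_k beta k <= sigma * (2 * n%:R `^ p^-1).
  rewrite -mulr_sumr ler_pM2l//; apply: le_trans (sum_powRB1_le n half_pV).
  by rewrite big_add1 big_mkord.
have sv : \sum_k nu k <= sigma ^+ 2 * (n%:R `^ p^-1) ^+ 2.
  rewrite -mulr_sumr ler_pM2l ?exprn_gt0//.
  have : 0 <= 2 / p - 1 by rewrite subr_ge0 ler_pdivlMr// mul1r.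
  move=> /(sum_powR_le n); rewrite big_add1 big_mkord => /le_trans; apply.
  rewrite powRB ?(gt_eqF n_gt0) ?implybT// (powRr1 (ltW n_gt0)).
  rewrite mulrC divfK ?gt_eqF// mulrC powRrM powR_mulrn ?powR_ge0//.
have WE : W = 5 * sigma ^+ 2 * ((n%:R `^ p^-1) ^+ 2 * n%:R^-1 ^+ 2).
  rewrite /W; congr (_ * _).
  have -> : - (2 * (p - 1) / p) = p^-1 * 2%:R - 2%:R by field; rewrite gt_eqF.
  rewrite powRB ?(gt_eqF n_gt0) ?implybT// powRrM !powR_mulrn ?powR_ge0//.
  by rewrite exprVn.
have sb0 : 0 <= \sum_k beta k.
  by apply: sumr_ge0 => k _; rewrite mulr_ge0 ?powR_ge0// ltW.
have sb2 : (\sum_k beta k) ^+ 2 <= (sigma * (2 * n%:R `^ p^-1)) ^+ 2.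
  by rewrite ler_pXn2r ?nnegrE// (le_trans sb0).
rewrite WE [leRHS](_ : _ = n%:R^-1 ^+ 2 *
    (5 * sigma ^+ 2 * (n%:R `^ p^-1) ^+ 2)); last by ring.
apply: ler_wpM2l; first exact: sqr_ge0.
apply: le_trans (lerD sb2 sv) _.
by rewrite !exprMn le_eqVlt; apply/orP; left; apply/eqP; ring.
Qed.

Let K_K0 t : (1 <= t <= T)%N -> K t `<=` K0.
Proof.
move=> /andP[_ tT] tk [/andP[h1 h2] h3]; split=> //.
by rewrite h1 (leq_trans (ltnW h2)).
Qed.

(** The squared norm expands into a double sum over the batch. Pairs of distinct samples contribute
    products of bias bounds; the diagonal contributes [nu] in addition. *)
Lemma noise_le t : (1 <= t <= T)%N -> \int[P]_w enorm (Z t w) ^+ 2 <= W.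
Proof.
move=> tT; apply: le_trans sum_noise_le.
pose i (k : 'I_n) := (t, k.+1).
have K0i k : K0 (i k) by split; rewrite //= ltn_ord.
have Ki k : ~ K t (i k) by move=> [/= /andP[_]]; rewrite ltnn.
have XD tk : K0 tk -> forall A, measurable A -> distribution P (X tk) A = D A.
  by case=> h1 h2; exact: iid.1.
have int_aa j k : P.-integrable setT (EFin \o (fun w => dot (a t j w) (a t k w))).
  apply: (bounded_integrable _ (M := (tau j + (1 + sigma `^ p)) *
                                     (tau k + (1 + sigma `^ p)))) => [|w].
    by apply: (@measurable_dot _ _ _ _ (a t j) (a t k)); exact: ma.
  by apply: ler_norm_dot; exact: a_le.
have ZE w : enorm (Z t w) ^+ 2 =
    n%:R^-1 ^+ 2 * \sum_(j < n) \sum_(k < n) dot (a t j w) (a t k w).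
  rewrite sqr_enorm dotZl dotZr mulrA -expr2 dot_suml; congr (_ * _).
  by apply: eq_bigr => j _; rewrite dot_sumr.
under eq_Rintegral do rewrite ZE.
have int_a j : P.-integrable setT
    (EFin \o (fun w => \sum_(k < n) dot (a t j w) (a t k w))).
  exact: integrableR_sum.
rewrite RintegralZl//; last exact: integrableR_sum.
apply: ler_wpM2l; first exact: sqr_ge0.
rewrite Rintegral_sum//.
(* The right side is spread over the same pairs, so that the comparison is term by term. *)
have -> : (\sum_k beta k) ^+ 2 + \sum_k nu k =
    \sum_(j < n) \sum_(k < n) (beta j * beta k + (if k == j then nu k else 0)).
  rewrite expr2 mulr_suml -big_split/=; apply: eq_bigr => j _.
  by rewrite mulr_sumr big_split/= -big_mkcond/= big_pred1_eq.
apply: ler_sum => j _; rewrite Rintegral_sum//; apply: ler_sum => k _.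
have mY := measurable_iterate (ltT tT).
case: eqVneq => [->|kj].
  rewrite addrC -expr2 -varE -biasE.
  exact: (Rintegral_dev_sqr_le p1 p2 mg mgF mean moment iid.2 XD (K_K0 tT) mY
    (K0i j) (Ki j) (tau_gt0 j)).
rewrite addr0 -!biasE.
apply: (Rintegral_dev_cross_le p1 mg mgF mean moment iid.2 XD (K_K0 tT) mY
  (K0i j) (K0i k) _ (Ki j) (Ki k) (tau_gt0 j) (tau_gt0 k)).
by apply: contraNneq kj => -[] /eqP; rewrite val_eqE => /eqP ->.
Qed.

Let grad_le y : enorm (grad F y) <= 1 + sigma `^ p.
Proof.
apply: (enorm_mean_le p1 _ (mean y) (moment y)).
exact: (mcoord_oracle mg (Y := fun=> y) (Z := id)).
Qed.

Lemma integrable_sqr_grad t : (1 <= t <= T)%N ->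
  P.-integrable setT (EFin \o (fun w => enorm (grad F (x t w)) ^+ 2)).
Proof.
move=> tT; apply: (bounded_integrable _ (M := (1 + sigma `^ p) ^+ 2)) => [|w].
  by apply: measurable_funX; apply: measurable_enorm;
    exact: (mcoord_grad mgF (mx (ltT tT))).
rewrite ger0_norm ?sqr_ge0// ler_pXn2r ?nnegrE ?enorm_ge0//.
exact: le_trans (enorm_ge0 _) (grad_le 0).
Qed.

Let integrable_F t : (1 <= t <= T.+1)%N ->
  P.-integrable setT (EFin \o (fun w => F (x t w))).
Proof.
move=> tT; have [M FM] := F_bounded tT; apply: bounded_integrable FM.
exact: (measurableT_comp mF (mx tT)).
Qed.

Let integrable_sqr_Z t : (1 <= t <= T)%N ->
  P.-integrable setT (EFin \o (fun w => enorm (Z t w) ^+ 2)).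
Proof.
move=> tT; apply: (bounded_integrable _ (M := B ^+ 2)) => [|w].
  apply: measurable_funX; apply: measurable_enorm; apply: mcoordZ.
  by apply: mcoord_sum => k; exact: ma.
rewrite ger0_norm ?sqr_ge0// ler_pXn2r ?nnegrE ?enorm_ge0//.
exact: le_trans (enorm_ge0 _) (Z_le t w).
Qed.

Let expected_step_le t : (1 <= t <= T)%N ->
  eta t * \int[P]_w enorm (grad F (x t w)) ^+ 2 <=
  2 * (\int[P]_w F (x t w) - \int[P]_w F (x t.+1 w)) + eta t * W.
Proof.
move=> tT; have /andP[eta0 _] := eta_bnd tT.
have iG := integrable_sqr_grad tT; have iZ := integrable_sqr_Z tT.
have iF := integrable_F (ltT tT).
have iF' : P.-integrable setT (EFin \o (fun w => F (x t.+1 w))).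
  by apply: integrable_F; case/andP: tT.
have iZG := integrableRZl (eta t / 2) (integrableRB iZ iG).
have : \int[P]_w F (x t.+1 w) <= \int[P]_w (F (x t w) +
    eta t / 2 * (enorm (Z t w) ^+ 2 - enorm (grad F (x t w)) ^+ 2)).
  apply: le_Rintegral => // [|w _]; last exact: step_le.
  exact: (integrableRD iF iZG).
rewrite RintegralD// RintegralZl//; last exact: (integrableRB iZ iG).
rewrite RintegralB//.
have : eta t * \int[P]_w enorm (Z t w) ^+ 2 <= eta t * W.
  by rewrite ler_pM2l// noise_le.
lra.
Qed.

Lemma weighted_sum_le :
  \sum_(1 <= t < T.+1) eta t * \int[P]_w enorm (grad F (x t w)) ^+ 2 <=
  2 * (F x1 - Fstar) + (\sum_(1 <= t < T.+1) eta t) * W.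
Proof.
(* Telescoping needs the statement for every [m <= T], with the expectation of [F (x m.+1)] kept; at
   [m = T] it is bounded below by [Fstar]. *)
suff H m : (m <= T)%N ->
    \sum_(1 <= t < m.+1) eta t * \int[P]_w enorm (grad F (x t w)) ^+ 2 <=
    2 * (F x1 - \int[P]_w F (x m.+1 w)) + (\sum_(1 <= t < m.+1) eta t) * W.
  apply: le_trans (H T (leqnn T)) _; rewrite lerD2r ler_pM2l// lerD2l lerN2.
  rewrite -[leLHS](Rintegral_prob_cst P); apply: le_Rintegral => //.
    exact: integrableR_cst.
  by apply: integrable_F; rewrite leqnn.
elim: m => [_|m IH mT].
  rewrite !big_geq// mul0r addr0; under eq_Rintegral do rewrite sgd.1.
  by rewrite Rintegral_prob_cst subrr mulr0.
rewrite !(big_nat_recr m.+1)//=.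
have := IH (ltnW mT); have := expected_step_le (t := m.+1) mT; lra.
Qed.

End ps_clip_sgd_iterates.

(** * Normalisation by the total step size *)

Theorem theorem3p1 (R : realType) (d : nat) (hd : (1 <= d)%N)
  (F : 'rV[R]_d -> R) (L Fstar : R) (hL : 0 < L)
  (hF : L_smooth L F) (hFstar : forall y, Fstar <= F y)
  (dX : measure_display) (Xi : measurableType dX) (D : probability Xi R)
  (g : 'rV[R]_d -> Xi -> 'rV[R]_d) (hg : measurable_oracle g)
  (p sigma : R) (hp : 1 < p <= 2) (hsigma : 0 < sigma)
  (hmean : unbiased D F g) (hmoment : bounded_moment D p sigma g)
  (T n : nat) (hT : (1 <= T)%N) (hn : (1 <= n)%N) (x1 : 'rV[R]_d)
  (eta : nat -> R)
  (heta : forall t : nat, (1 <= t <= T)%N -> 0 < eta t < L^-1)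
  (dO : measure_display) (Omega : measurableType dO) (P : probability Omega R)
  (xi : nat -> nat -> {mfun Omega >-> Xi}) (hxi : iid_samples P D T n xi)
  (x : nat -> Omega -> 'rV[R]_d)
  (hx : ps_clip_sgd g sigma p n T eta (fun t k => xi t k : Omega -> Xi) x1 x) :
  (\sum_(1 <= t < T.+1)
      ((eta t)%:E * 'E_P[fun w => (enorm (grad F (x t w)) ^+ 2)%R]
       / (\sum_(1 <= s < T.+1) eta s)%R%:E)
   <= (2 * (F x1 - Fstar) / (\sum_(1 <= t < T.+1) eta t)
       + 8 * sigma ^+ 2 * n%:R `^ (- (2 * (p - 1) / p)))%R%:E)%E.
Proof.
move: hp => /andP[p1 p2].
set S := \sum_(1 <= s < T.+1) eta s.
(* As [T >= 1], the sum has a positive first term; the others are nonnegative. *)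
have S0 : 0 < S.
  rewrite /S big_ltn//; apply: ltr_wpDr.
    rewrite big_seq; apply: sumr_ge0 => t; rewrite mem_index_iota => /andP[t2 tT].
    by have /heta/andP[/ltW] : (1 <= t <= T)%N by rewrite (ltnW t2).
  by have /heta/andP[] : (1 <= 1 <= T)%N by [].
(* Integrability of the squared gradient norm and [S != 0] turn each extended-real term into a real
   number. *)
have termE t : (1 <= t < T.+1)%N ->
    ((eta t)%:E * 'E_P[fun w => (enorm (grad F (x t w)) ^+ 2)%R] / S%:E)%E =
    (eta t * \int[P]_w enorm (grad F (x t w)) ^+ 2 / S)%:E.
  move=> tT; rewrite inver gt_eqF// unlock Rintegral_EFin ?EFinM//.
  exact: (integrable_sqr_grad hL hF hg p1 hmean hmoment P hx tT).
rewrite (eq_big_nat _ _ termE) sumEFin lee_fin -mulr_suml.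
have H := weighted_sum_le hL hF hFstar hg p1 p2 hsigma hmean hmoment hn heta hxi hx.
apply: le_trans (ler_wpM2r _ H) _; first by rewrite invr_ge0 ltW.
rewrite -/S mulrDl lerD2l mulrAC divff ?gt_eqF// mul1r.
(* The constant 5 of the noise bound is relaxed to 8. *)
by rewrite ler_wpM2r ?powR_ge0// ler_wpM2r ?sqr_ge0// ler_nat.
Qed.
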